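(* The function $\lfloor\sqrt[m]{n}\rfloor$ (for integer arguments $n\ge1$ and $m\ge2$) can be represented by the arithmetic term $$\mathrm{HW}(M(m,n))/\bigl(2^{nm^2+nm+2}+2(nm^2+nm)+9\bigr)-2^{7(nm^2+nm+1)}-1,$$ i.e. $\lfloor\sqrt[m]{n}\rfloor$ equals this expression for all integers $n\ge1$, $m\ge2$, where $$\begin{aligned}M(m,n)={}&\mathcal C(2+n^2,7)+\mathcal A(-2mx_1x_2,7)+\mathcal A((m^2+1)x_1^2,7)+\mathcal A(-x_42^{x_1+1},7)\\ &+\mathcal A(-2x_1,7)+\mathcal A(-2(m+1)x_1x_7,7)+\mathcal A(x_2^2,7)+\mathcal A(-x_52^{x_1+1},7)\\ &+\mathcal A(2x_5,7)+\mathcal A(2x_4x_5,7)+\mathcal A(3x_4^2,7)+\mathcal A(-x_72^{x_1+1},7)\\ &+\mathcal A(2(1-n)x_4,7)+\mathcal A(2x_4x_6,7)+\mathcal A(x_5^2,7)+\mathcal A(-x_42^{x_2+1},7)\\ &+\mathcal A(-2nx_6,7)+\mathcal A(2x_4x_7,7)+\mathcal A(x_6^2,7)+\mathcal A(x_3x_42^{x_1+1},7)\\ &+\mathcal A(2(m+2)x_7,7)+\mathcal A(2x_5x_7,7)+\mathcal A((m^2+2m+2)x_7^2,7)+\mathcal A(x_3x_72^{x_2+1},7)\\ &+\mathcal A(-2x_3x_4x_7,7)+\mathcal A(-2^{x_1+1},7)+\mathcal A(2^{2x_1},7)+\mathcal A(-x_3^2x_72^{x_1+1},7)\\ &+\mathcal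 A(x_3^2x_7^2,7)+\mathcal A(x_3^22^{2x_1},7)+\mathcal A(2^{2x_2},7)+\mathcal A(-x_32^{x_1+x_2+1},7),\end{aligned}$$ with $\mathcal C$ and $\mathcal A$ formed with the parameters $t=2^{nm^2+nm+1}$ and $w=2^{nm^2+nm+2}+2(nm^2+nm)+9$.
   Context: $\mathrm{HW}(N)$ is the Hamming weight of $N$ (number of ones in its binary representation). $G_r(q,s)=\sum_{j=0}^{s}j^rq^j$ with $0^0=1$; for each fixed $r$ this has a closed form. Given parameters $t>1$, $w$ (depending on the arguments) and $k\ge1$: $$\mathcal C(\varepsilon,k)=(2^w-\varepsilon+1)\,\frac{2^{2wt^k}-1}{2^w+1},$$ and for a monomial $\mu=\alpha\, b_1^{\beta_1x_1}\cdots b_k^{\beta_kx_k}x_1^{\gamma_1}\cdots x_k^{\gamma_k}$ in the formal variables $x_1,\dots,x_k$ (with $\alpha$ an integer possibly negative, and absent exponential factors meaning $\beta_i=0$, absent powers meaning $\gamma_i=0$; e.g. $-x_32^{x_1+x_2+1}$ has $\alpha=-2$, $b_1=b_2=2$, $\beta_1=\beta_2=1$, $\gamma_3=1$), $$\mathcal A(\mu,k)=-(2^w-1)\,\alpha\prod_{i=1}^kG_{\gamma_i}\!\left(2^{2wt^{i-1}}b_i^{\beta_i},\,t-1\right).$$ An arithmetic term is an expression built from natural-number constants and the variables by the operations $x+y$, $\max(x-y,0)$, $\lfloor x/y\rfloor$, $x^y$ (with $0^0=1$, $\lfloor x/0\rfloor=0$). Products, $\mathrm{HW}$ and $G_r$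 (fixed $r$) are expressible by arithmetic terms and are used as abbreviations; formulas are written with ordinary subtraction and exact division for readability. *)

(* Defs.v *)
From mathcomp Require Import all_boot all_order all_algebra all_field.

Set Implicit Arguments.
Unset Strict Implicit.
Unset Printing Implicit Defensive.

Import Order.TTheory GRing.Theory Num.Theory.

Local Open Scope ring_scope.

(* Multiplication is deliberately not a constructor. In [aeval], [-] is the
   truncated subtraction, x %/ 0 = 0 and 0 ^ 0 = 1. *)
Inductive aterm (k : nat) : Type :=
| AVar of 'I_k
| ACst of nat
| AAdd of aterm k & aterm k
| ASub of aterm k & aterm k
| ADiv of aterm k & aterm k
| AExp of aterm k & aterm k.

Fixpoint aeval (k : nat) (T : aterm k) (v : k.-tuple nat) : nat :=
  match T with
  | AVar i => tnth v i
  | ACst c => c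
  | AAdd T1 T2 => aeval T1 v + aeval T2 v
  | ASub T1 T2 => aeval T1 v - aeval T2 v
  | ADiv T1 T2 => aeval T1 v %/ aeval T2 v
  | AExp T1 T2 => aeval T1 v ^ aeval T2 v
  end%N.

(* The bits of N of rank i >= N all vanish, since N < 2 ^ N. *)
Definition HW (N : nat) : nat := (\sum_(i < N) odd (N %/ 2 ^ i))%N.

Definition G (r q s : nat) : nat := (\sum_(0 <= j < s.+1) j ^ r * q ^ j)%N.

(* coef * \prod_i (base i ^ (bexp i * x_i) * x_i ^ (pexp i)), where the
   variables x_i are numbered from i = 1 *)
Record monomial : Type := Monomial {
  coef : int;
  base : nat -> nat;
  bexp : nat -> nat;
  pexp : nat -> nat }.

(* The division is exact: 2 ^ w + 1 divides 2 ^ (2 * w) - 1. *)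
Definition calC (t w : nat) (eps : int) (k : nat) : int :=
  (2 ^+ w - eps + 1)
    * ((2 ^+ (2 * w * t ^ k)%N - 1) %/ (2 ^+ w + 1))%Z.

Definition calA (t w : nat) (mu : monomial) (k : nat) : int :=
  - (2 ^+ w - 1) * coef mu
    * \prod_(1 <= i < k.+1)
        (G (pexp mu i) (2 ^ (2 * w * t ^ i.-1) * base mu i ^ bexp mu i)%N
           t.-1)%:Z.

Definition exponents (s : seq (nat * nat)) (i : nat) : nat :=
  (\sum_(p <- s | p.1 == i) p.2)%N.

(* Monomials all of whose bases are 2: [be] lists the pairs (i, beta_i) and
   [ga] the pairs (i, gamma_i), the exponents of the absent indices being 0. *)
Definition mon2 (a : int) (be ga : seq (nat * nat)) : monomial :=
  Monomial a (fun=> 2%N) (exponents be) (exponents ga).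

Definition root_t (m n : nat) : nat := (2 ^ (n * m ^ 2 + n * m + 1))%N.

Definition root_w (m n : nat) : nat :=
  (2 ^ (n * m ^ 2 + n * m + 2) + 2 * (n * m ^ 2 + n * m) + 9)%N.

Definition root_monomials (m n : int) : seq monomial := [::
  (* -2 m x1 x2 *)           mon2 (- (2 * m)) [::] [:: (1, 1); (2, 1)];
  (* (m^2 + 1) x1^2 *)       mon2 (m ^+ 2 + 1) [::] [:: (1, 2)];
  (* -x4 2^(x1 + 1) *)       mon2 (- 2) [:: (1, 1)] [:: (4, 1)];
  (* -2 x1 *)                mon2 (- 2) [::] [:: (1, 1)];
  (* -2 (m + 1) x1 x7 *)     mon2 (- (2 * (m + 1))) [::] [:: (1, 1); (7, 1)];
  (* x2^2 *)                 mon2 1 [::] [:: (2, 2)];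
  (* -x5 2^(x1 + 1) *)       mon2 (- 2) [:: (1, 1)] [:: (5, 1)];
  (* 2 x5 *)                 mon2 2 [::] [:: (5, 1)];
  (* 2 x4 x5 *)              mon2 2 [::] [:: (4, 1); (5, 1)];
  (* 3 x4^2 *)               mon2 3 [::] [:: (4, 2)];
  (* -x7 2^(x1 + 1) *)       mon2 (- 2) [:: (1, 1)] [:: (7, 1)];
  (* 2 (1 - n) x4 *)         mon2 (2 * (1 - n)) [::] [:: (4, 1)];
  (* 2 x4 x6 *)              mon2 2 [::] [:: (4, 1); (6, 1)];
  (* x5^2 *)                 mon2 1 [::] [:: (5, 2)];
  (* -x4 2^(x2 + 1) *)       mon2 (- 2) [:: (2, 1)] [:: (4, 1)];
  (* -2 n x6 *)              mon2 (- (2 * n)) [::] [:: (6, 1)];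
  (* 2 x4 x7 *)              mon2 2 [::] [:: (4, 1); (7, 1)];
  (* x6^2 *)                 mon2 1 [::] [:: (6, 2)];
  (* x3 x4 2^(x1 + 1) *)     mon2 2 [:: (1, 1)] [:: (3, 1); (4, 1)];
  (* 2 (m + 2) x7 *)         mon2 (2 * (m + 2)) [::] [:: (7, 1)];
  (* 2 x5 x7 *)              mon2 2 [::] [:: (5, 1); (7, 1)];
  (* (m^2 + 2 m + 2) x7^2 *) mon2 (m ^+ 2 + 2 * m + 2) [::] [:: (7, 2)];
  (* x3 x7 2^(x2 + 1) *)     mon2 2 [:: (2, 1)] [:: (3, 1); (7, 1)];
  (* -2 x3 x4 x7 *)          mon2 (- 2) [::] [:: (3, 1); (4, 1); (7, 1)];
  (* -2^(x1 + 1) *)          mon2 (- 2) [:: (1, 1)] [::];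
  (* 2^(2 x1) *)             mon2 1 [:: (1, 2)] [::];
  (* -x3^2 x7 2^(x1 + 1) *)  mon2 (- 2) [:: (1, 1)] [:: (3, 2); (7, 1)];
  (* x3^2 x7^2 *)            mon2 1 [::] [:: (3, 2); (7, 2)];
  (* x3^2 2^(2 x1) *)        mon2 1 [:: (1, 2)] [:: (3, 2)];
  (* 2^(2 x2) *)             mon2 1 [:: (2, 2)] [::];
  (* -x3 2^(x1 + x2 + 1) *)  mon2 (- 2) [:: (1, 1); (2, 1)] [:: (3, 1)]
  ]%N.

Definition root_M (m n : nat) : int :=
  let t := root_t m n in
  let w := root_w m n in
  calC t w (2 + n%:Z ^+ 2) 7
    + \sum_(mu <- root_monomials m n) calA t w mu 7.

Definition root_expr (m n : nat) : int :=
  (HW `|root_M m n| %/ root_w m n)%N%:Z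
    - 2 ^+ (7 * (n * m ^ 2 + n * m + 1))%N - 1.

(* Main.v *)
Require Import Defs.
From mathcomp Require Import all_boot all_order all_algebra all_field.
From mathcomp Require Import zify ring.

(** The root is obtained by counting the integers a >= 0 with a^m <= n, and the
    Hamming weight does the counting.

    Let t and w be the parameters, and read an integer e < t ^ 7 in base t: its
    digits are a point (x_1, ..., x_7) of the box [0, t - 1]^7. Expanding the
    product of the sums G over the seven coordinates turns each A(mu, 7) into a
    sum over the points of the box (calA_sum), and M(m, n) into

      sum over e of  2^(2we) (2^w - 1) (2^w + 1 - P(x)),

    where P(x) is 2 + n^2 plus the sum of the monomials mu at x. When
    0 <= P <= 2^w on the box, the summands occupy disjoint blocks of 2w bits. If
    P(x) = 0 the block is 2^(2w) - 1, of weight 2w; otherwise it is (2^w - 1) a with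
    1 <= a <= 2^w, and such a product always has weight w (HW_mul_pred). Hence
    HW(M) = w (t^7 + number of zeros of P in the box): this is HW_calC_calA.

    Here P is a sum of five squares (root_polyE), which vanish together exactly
    when, writing a for x_7,

      x_1 = (m + 1) a + 1,   x_2 = m x_1,   x_4 + x_6 = n,
      x_4 + x_5 + a + 1 = 2^(x_1),   2^(x_2) = x_4 + x_3 (2^(x_1) - a).

    The last two conditions say that x_4 is the remainder of (2^(x_1))^m modulo
    2^(x_1) - a. Modulo this number 2^(x_1) is a, and x_1 is large enough for
    a^m to be smaller than the modulus (modulus_gt), so x_4 = a^m. The third one
    then says a^m <= n, and everything else is a function of a. Since the
    parameters are large enough for these solutions to lie in the box
    (root_sol_lt) and for P to be at most 2^w on it (root_poly_bound,
    root_w_large), the zeros correspond to the a with a^m <= n, and there are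
    floor(n^(1/m)) + 1 of them.

    It remains to write the expression as an arithmetic term. Products come from
    squares, G_r from a recursion on r (G_rec). For the Hamming weight, Legendre's
    formula gives HW(N) = v_2(C(2N, N)) (HW_logn); binomials are digits of a power
    (bin_digit), the 2-part of u is gcd(u, 2^u), the gcd is a digit of a product of
    two geometric sums (gcd_digit), and the exponent v is read off 2^v by expanding
    (1 + y)^v modulo y^2 (log2_mod). *)

Set Implicit Arguments.
Unset Strict Implicit.
Unset Printing Implicit Defensive.

Import Order.TTheory GRing.Theory Num.Theory.

Local Open Scope nat_scope.

(** * Hamming weight *)

(** The rank at which the sum defining [HW] stops is immaterial, as long as no bit
    of [N] is left out. *)
Lemma HW_wide (L N : nat) : N < 2 ^ L -> HW N = \sum_(i < L) odd (N %/ 2 ^ i).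
Proof.
move=> ltN; have zero i : N < 2 ^ i -> odd (N %/ 2 ^ i) = 0 :> nat.
  by move=> lt_i; rewrite divn_small.
rewrite /HW -!(big_mkord xpredT (fun i => odd (N %/ 2 ^ i) : nat)).
have widen a b : a <= b -> N < 2 ^ a ->
    \sum_(0 <= i < a) odd (N %/ 2 ^ i) = \sum_(0 <= i < b) odd (N %/ 2 ^ i).
  move=> le_ab lt_a; rewrite (@big_cat_nat _ _ _ a _ _ _ _ (leq0n _) le_ab) /=.
  rewrite [X in _ = _ + X]big_nat_cond [X in _ = _ + X]big1 ?addn0 //.
  move=> i /andP[/andP[ge_i _] _]; apply: zero.
  by apply: leq_trans lt_a _; rewrite leq_exp2l.
rewrite (widen _ _ (leq_addr L N) (ltn_expl N (ltnSn 1))).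
by rewrite (widen _ _ (leq_addl N L) ltN).
Qed.

Lemma HW0 : HW 0 = 0. Proof. by rewrite /HW big_ord0. Qed.

Lemma HW_cat (L a b : nat) : a < 2 ^ L -> HW (a + 2 ^ L * b) = HW a + HW b.
Proof.
move=> lt_a; have lt_b : b < 2 ^ b by apply: ltn_expl.
have lt_ab : a + 2 ^ L * b < 2 ^ (L + b).
  rewrite expnD; apply: (@leq_trans (2 ^ L * b.+1)); last by rewrite leq_mul.
  by rewrite mulnS ltn_add2r.
rewrite (HW_wide lt_ab) (HW_wide lt_a) (HW_wide lt_b) big_split_ord /=.
congr (_ + _); apply: eq_bigr => i _; last first.
  rewrite expnD divnMA [a + _]addnC [2 ^ L * b]mulnC divnMDl ?expn_gt0 //.
  by rewrite (divn_small lt_a) addn0.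
have lt_i := ltn_ord i.
have -> : 2 ^ L * b = (2 ^ (L - i).-1 * b).*2 * 2 ^ i.
  have -> : 2 ^ L = 2 ^ (L - i).-1 * 2 * 2 ^ i.
    by rewrite -expnSr -expnD; congr (_ ^ _); lia.
  by rewrite -muln2; ring.
by rewrite [a + _]addnC divnMDl ?expn_gt0 // oddD odd_double.
Qed.

(** Complementing the [w] low bits of [c] swaps its ones and its zeros. *)
Lemma HW_compl (w c : nat) : c < 2 ^ w -> HW c + HW (2 ^ w - 1 - c) = w.
Proof.
elim: w c => [|w IH] c lt_c; first by case: c lt_c => //= _; rewrite HW0.
have lt2 (b : bool) : (b : nat) < 2 ^ 1 by case: b.
have HWb (b : bool) : HW b = b by case: b; rewrite ?HW0 // /HW big_ord_recl big_ord0.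
have lt_h : c./2 < 2 ^ w by move: lt_c; rewrite expnS; lia.
have -> : 2 ^ w.+1 - 1 - c = ~~ odd c + 2 ^ 1 * (2 ^ w - 1 - c./2).
  by move: lt_c; rewrite expnS expn1; have := odd_double_half c; lia.
have {1}-> : c = odd c + 2 ^ 1 * c./2 by rewrite expn1; lia.
rewrite !HW_cat // !HWb; have := IH _ lt_h; lia.
Qed.

(** Writing [(2 ^ w - 1) * a] as [(a - 1) * 2 ^ w + (2 ^ w - 1 - (a - 1))] shows its
    binary expansion to be that of [a - 1] followed by its complement. *)
Lemma HW_mul_pred (w a : nat) : 0 < a <= 2 ^ w -> HW ((2 ^ w - 1) * a) = w.
Proof.
move=> /andP[a_gt0 le_a].
have -> : (2 ^ w - 1) * a = (2 ^ w - 1 - a.-1) + 2 ^ w * a.-1.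
  by rewrite mulnBl mul1n; case: a a_gt0 le_a => //= a _ le_a; rewrite mulnS; lia.
rewrite HW_cat; last by lia.
by rewrite addnC HW_compl //; lia.
Qed.

Lemma HW_blocks (L N : nat) (F : nat -> nat) :
    (forall e, e < N -> F e < 2 ^ L) ->
  \sum_(0 <= e < N) 2 ^ (L * e) * F e < 2 ^ (L * N)
  /\ HW (\sum_(0 <= e < N) 2 ^ (L * e) * F e) = \sum_(0 <= e < N) HW (F e).
Proof.
elim: N => [|N IH] ltF; first by rewrite !big_geq // HW0 muln0.
have [|lt_S HW_S] := IH; first by move=> e lt_e; apply: ltF; lia.
rewrite !big_nat_recr //= HW_cat // HW_S; split=> //.
rewrite mulnS addnC expnD; apply: (@leq_trans (2 ^ (L * N) * (F N).+1)).
  by rewrite mulnS addnC -addSn leq_add2r.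
by rewrite mulnC leq_mul2r ltF ?orbT.
Qed.

(** Legendre's formula: each bit of [N] is the difference between a quotient
    [N %/ 2 ^ i] and twice the next one, and these quotients sum to the valuation. *)
Lemma logn2_fact (N : nat) : logn 2 N`! + HW N = N.
Proof.
rewrite logn_fact // /HW big_add1 /= -(big_mkord xpredT (fun i => odd (N %/ 2 ^ i) : nat)).
have : \sum_(0 <= i < N) (odd (N %/ 2 ^ i) + (N %/ 2 ^ i.+1).*2) = \sum_(0 <= i < N) N %/ 2 ^ i.
  apply: eq_bigr => i _; rewrite expnSr divnMA divn2; exact: odd_double_half.
have : \sum_(0 <= i < N.+1) N %/ 2 ^ i = N + \sum_(0 <= i < N) N %/ 2 ^ i.+1.
  by rewrite big_nat_recl //= expn0 divn1.
rewrite big_nat_recr //= (divn_small (ltn_expl N (ltnSn 1))) addn0 => ->.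
rewrite big_split /=.
have -> : \sum_(0 <= i < N) (N %/ 2 ^ i.+1).*2 = (\sum_(0 <= i < N) N %/ 2 ^ i.+1).*2.
  by rewrite -mul2n big_distrr /=; apply: eq_bigr => i _; rewrite mul2n.
set S := \sum_(0 <= i < N) N %/ _; set H := \sum_(0 <= i < N) _.
by lia.
Qed.

(** This is what makes [HW] expressible by an arithmetic term. *)
Lemma HW_logn (N : nat) : HW N = logn 2 'C(N.*2, N).
Proof.
have := @bin_fact N.*2 N; rewrite -addnn leq_addr addnK => /(_ isT) /(congr1 (logn 2)).
have gt0 : 0 < 'C(N + N, N) by rewrite bin_gt0 leq_addr.
rewrite !lognM ?muln_gt0 ?fact_gt0 //.
have := logn2_fact N; have := logn2_fact (N + N).
have -> : HW (N + N) = HW N by have := @HW_cat 1 0 N isT; rewrite HW0 add0n expn1 mul2n -addnn.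
lia.
Qed.

(** * Digits in base t *)

Definition digit (t e i : nat) : nat := e %/ t ^ i %% t.

Lemma digits_lt (t k : nat) (d : nat -> nat) : (forall i, d i < t) ->
  \sum_(0 <= i < k) d i * t ^ i < t ^ k.
Proof.
move=> lt_d; elim: k => [|k IH]; first by rewrite big_geq.
rewrite big_nat_recr //= expnS; apply: (@leq_trans ((d k).+1 * t ^ k)).
  by rewrite mulSn -addSn leq_add2r.
by rewrite leq_mul2r lt_d orbT.
Qed.

Lemma digit_sum (t k i : nat) (d : nat -> nat) : (forall i, d i < t) -> i < k ->
  digit t (\sum_(0 <= j < k) d j * t ^ j) i = d i.
Proof.
move=> lt_d lt_i; have t_gt0 : 0 < t by apply: leq_trans (lt_d 0).
rewrite /digit (@big_cat_nat _ _ _ i.+1) //= big_nat_recr //=.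
have -> : \sum_(i.+1 <= j < k) d j * t ^ j
    = (\sum_(i.+1 <= j < k) d j * t ^ (j - i.+1)) * t * t ^ i.
  rewrite -mulnA -expnS big_distrl /= !big_nat; apply: eq_bigr => j /andP[lt_ij _].
  by rewrite -mulnA -expnD subnK.
rewrite -addnA -mulnDl addnC divnMDl ?expn_gt0 ?t_gt0 //.
by rewrite (divn_small (digits_lt _ lt_d)) addn0 addnC modnMDl modn_small.
Qed.

Lemma sum_digit (t k e : nat) : 0 < t -> e < t ^ k ->
  \sum_(0 <= i < k) digit t e i * t ^ i = e.
Proof.
move=> t_gt0; elim: k e => [|k IH] e lt_e.
  by rewrite big_geq //; case: e lt_e.
rewrite big_nat_recr //= /digit [X in _ + X * _]modn_small; last first.
  by rewrite ltn_divLR ?expn_gt0 ?t_gt0 // -expnS.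
rewrite [RHS](divn_eq e (t ^ k)) addnC; congr (_ + _).
rewrite -[RHS]IH ?ltn_mod ?expn_gt0 ?t_gt0 //; apply: eq_big_nat => i /andP[_ lt_i].
congr (_ * _); rewrite /digit {1}(divn_eq e (t ^ k)).
have -> : t ^ k = t ^ (k - i).-1 * t * t ^ i.
  by rewrite -expnSr -expnD; congr (_ ^ _); lia.
by rewrite !mulnA divnMDl ?expn_gt0 ?t_gt0 // modnMDl.
Qed.

Lemma big_mul_split (R : Type) (idx : R) (op : Monoid.law idx) (a b : nat) (f : nat -> R) :
  \big[op/idx]_(0 <= e < a * b) f e
    = \big[op/idx]_(0 <= j < b) \big[op/idx]_(0 <= e < a) f (e + j * a).
Proof.
rewrite mulnC big_nat_mul; apply: eq_bigr => j _.
by rewrite -[j * a in LHS]add0n big_addn mulSn addnK.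
Qed.

(** * Closure properties of arithmetic terms *)

Definition arith (k : nat) (f : k.-tuple nat -> nat) : Prop :=
  exists T : aterm k, forall v, aeval T v = f v.

Lemma arith_ext (k : nat) (f g : k.-tuple nat -> nat) : f =1 g -> arith f -> arith g.
Proof. by move=> fg [T TE]; exists T => v; rewrite TE fg. Qed.

Lemma arith_cst (k c : nat) : arith (fun _ : k.-tuple nat => c).
Proof. by exists (ACst k c). Qed.

Lemma arith_var (k : nat) (i : 'I_k) : arith (fun v : k.-tuple nat => tnth v i).
Proof. by exists (AVar i). Qed.

Section Closure.
Variable k : nat.
Implicit Types f g h : k.-tuple nat -> nat.

Lemma arith_add f g : arith f -> arith g -> arith (fun v => f v + g v).
Proof. by move=> [F FE] [K KE]; exists (AAdd F K) => v /=; rewrite FE KE. Qed.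

Lemma arith_sub f g : arith f -> arith g -> arith (fun v => f v - g v).
Proof. by move=> [F FE] [K KE]; exists (ASub F K) => v /=; rewrite FE KE. Qed.

Lemma arith_div f g : arith f -> arith g -> arith (fun v => f v %/ g v).
Proof. by move=> [F FE] [K KE]; exists (ADiv F K) => v /=; rewrite FE KE. Qed.

Lemma arith_exp f g : arith f -> arith g -> arith (fun v => f v ^ g v).
Proof. by move=> [F FE] [K KE]; exists (AExp F K) => v /=; rewrite FE KE. Qed.

(** Only squaring is primitive, as the power of exponent 2; the polarization
    identity gives the product. *)
Lemma arith_mul f g : arith f -> arith g -> arith (fun v => f v * g v).
Proof.
move=> df dg.
apply: (@arith_ext _ (fun v => ((f v + g v) ^ 2 - (f v ^ 2 + g v ^ 2)) %/ 2)).
  by move=> v; rewrite sqrnD addKn mulKn.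
have sq h : arith h -> arith (fun v => h v ^ 2).
  by move=> dh; apply: arith_exp => //; exact: arith_cst.
apply: arith_div; last exact: arith_cst.
apply: arith_sub; first by apply/sq/arith_add.
by apply: arith_add; apply: sq.
Qed.

Lemma arith_mod f g : arith f -> arith g -> arith (fun v => f v %% g v).
Proof.
move=> df dg; apply: (@arith_ext _ (fun v => f v - f v %/ g v * g v)).
  by move=> v; rewrite {1}(divn_eq (f v) (g v)) addKn.
by apply: arith_sub => //; apply: arith_mul => //; apply: arith_div.
Qed.

Lemma arith_sum (r : nat) (F : nat -> k.-tuple nat -> nat) :
  (forall i, i < r -> arith (F i)) -> arith (fun v => \sum_(0 <= i < r) F i v).
Proof.
elim: r => [|r IH] dF.
  by apply: arith_ext (arith_cst _ 0) => v; rewrite big_geq.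
apply: (@arith_ext _ (fun v => \sum_(0 <= i < r) F i v + F r v)) => [v|].
  by rewrite big_nat_recr.
by apply: arith_add; [apply: IH => i lt_i; apply: dF; lia | apply: dF].
Qed.

Lemma arith_prod (r : nat) (F : nat -> k.-tuple nat -> nat) :
  (forall i, i < r -> arith (F i)) -> arith (fun v => \prod_(0 <= i < r) F i v).
Proof.
elim: r => [|r IH] dF.
  by apply: arith_ext (arith_cst _ 1) => v; rewrite big_geq.
apply: (@arith_ext _ (fun v => \prod_(0 <= i < r) F i v * F r v)) => [v|].
  by rewrite big_nat_recr.
by apply: arith_mul; [apply: IH => i lt_i; apply: dF; lia | apply: dF].
Qed.

End Closure.

(** Multiplying the sum by [q] shifts the index, and the binomial theorem expresses
    the shifted powers through the sums of lower or equal exponent. Read as an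
    equation for [G r q s], with coefficient [q - 1], it gives a closed form by
    induction on [r]. *)
Lemma G_rec (r q s : nat) :
  q * G r q s + q * (\sum_(0 <= i < r) 'C(r, i) * G i q s) + (r == 0)
    = s.+1 ^ r * q ^ s.+1 + G r q s.
Proof.
have -> : s.+1 ^ r * q ^ s.+1 + G r q s = \sum_(0 <= j < s.+2) j ^ r * q ^ j.
  by rewrite [RHS]big_nat_recr //= addnC.
rewrite big_nat_recl //= expn0 muln1 addnC; congr (_ + _).
  by case: (r) => [|r1]; rewrite ?expn0 ?exp0n.
rewrite addnC -mulnDr.
have -> : \sum_(0 <= i < r) 'C(r, i) * G i q s + G r q s = \sum_(0 <= i < r.+1) 'C(r, i) * G i q s.
  by rewrite [RHS]big_nat_recr //= binn mul1n.
under eq_bigr => i _ do rewrite /G big_distrr /=.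
rewrite exchange_big /= big_distrr /=; apply: eq_bigr => j _.
have -> : j.+1 ^ r = \sum_(0 <= i < r.+1) 'C(r, i) * j ^ i.
  rewrite -add1n expnDn big_mkord; apply: eq_bigr => i _.
  by rewrite exp1n mul1n.
rewrite big_distrr big_distrl /=; apply: eq_bigr => i _.
by rewrite expnS; ring.
Qed.

Lemma arith_G (k r : nat) (f g : k.-tuple nat -> nat) :
  arith f -> arith g -> (forall v, 1 < f v) -> arith (fun v => G r (f v) (g v)).
Proof.
move=> df dg f_gt1; elim/ltn_ind: r => r IH.
apply: (@arith_ext _ (fun v => ((g v + 1) ^ r * f v ^ (g v + 1)
    - (f v * (\sum_(0 <= i < r) 'C(r, i) * G i (f v) (g v)) + (r == 0))) %/ (f v - 1))).
  move=> v; have := G_rec r (f v) (g v); rewrite !addn1 => GE.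
  have -> : (g v).+1 ^ r * f v ^ (g v).+1
      - (f v * (\sum_(0 <= i < r) 'C(r, i) * G i (f v) (g v)) + (r == 0))
      = G r (f v) (g v) * (f v - 1).
    have f1 := f_gt1 v; rewrite mulnBr muln1 mulnC.
    have : G r (f v) (g v) <= f v * G r (f v) (g v) by rewrite leq_pmull; lia.
    lia.
  by rewrite mulnK // subn_gt0.
have dg1 : arith (fun v => g v + 1) by apply: arith_add => //; apply: arith_cst.
apply: arith_div; last by apply: arith_sub => //; apply: arith_cst.
apply: arith_sub.
  by apply: arith_mul; apply: arith_exp => //; apply: arith_cst.
apply: arith_add; last exact: arith_cst.
apply: arith_mul => //; apply: arith_sum => i lt_i.
by apply: arith_mul; [apply: arith_cst | apply: IH].
Qed.

Lemma bin_leq_exp2 (n i : nat) : 'C(n, i) <= 2 ^ n.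
Proof.
elim: n i => [|n IH] [|i] //; first by rewrite bin0 expn_gt0.
by rewrite binS expnS mul2n -addnn leq_add.
Qed.

(** Evaluating (1 + X)^n at a base exceeding all the coefficients makes them digits. *)
Lemma bin_digit (n i : nat) : 'C(n, i) = digit (2 ^ n + 1) ((2 ^ n + 2) ^ n) i.
Proof.
have lt_bin j : 'C(n, j) < 2 ^ n + 1 by rewrite addn1 ltnS bin_leq_exp2.
have powE : (2 ^ n + 2) ^ n = \sum_(0 <= j < n.+1) 'C(n, j) * (2 ^ n + 1) ^ j.
  rewrite -[2]/(1 + 1) addnA addnC expnDn big_mkord; apply: eq_bigr => j _.
  by rewrite exp1n mul1n.
rewrite powE; have [lt_i|le_i] := ltnP i n.+1; first by rewrite digit_sum.
rewrite bin_small // /digit divn_small ?mod0n //.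
apply: leq_trans (digits_lt n.+1 lt_bin) _.
by rewrite leq_exp2l //; have := expn_gt0 2 n; lia.
Qed.

Lemma arith_bin (k : nat) (f g : k.-tuple nat -> nat) :
  arith f -> arith g -> arith (fun v => 'C(f v, g v)).
Proof.
move=> df dg; apply: arith_ext (fun v => esym (bin_digit (f v) (g v))) _.
have d2 : arith (fun v => 2 ^ f v) by apply: arith_exp => //; apply: arith_cst.
have dB : arith (fun v => 2 ^ f v + 1) by apply: arith_add => //; apply: arith_cst.
apply: arith_mod => //; apply: arith_div; apply: arith_exp => //.
by apply: arith_add => //; apply: arith_cst.
Qed.

Lemma sum_eqmul (M N a : nat) : 0 < M -> a <= M * N ->
  \sum_(0 <= i < N.+1) (M * i == a) = (M %| a).
Proof.
move=> M_gt0 le_a; have [/dvdnP[b ab]|Nd] := boolP (M %| a); last first.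
  rewrite big1 // => i _; case: eqP => // ai.
  by rewrite -ai dvdn_mulr in Nd.
have le_b : b < N.+1 by rewrite ltnS -(leq_pmul2l M_gt0) mulnC -ab.
rewrite big_mkord (bigD1 (Ordinal le_b)) //= ab [b * M]mulnC eqxx big1 // => i.
by rewrite -val_eqE /= eqn_pmul2l // => /negPf ->.
Qed.

Lemma sum_dvdn_gcd (u M : nat) : 0 < M ->
  \sum_(0 <= j < M.+1) (M %| u * j) = (gcdn u M).+1.
Proof.
move=> M_gt0; have g_gt0 : 0 < gcdn u M by rewrite gcdn_gt0 M_gt0 orbT.
rewrite big_nat_recl //= muln0 dvdn0 add1n; congr _.+1.
have dM : M %/ gcdn u M %| M by apply: dvdn_div; apply: dvdn_gcdr.
have -> : gcdn u M = M %/ (M %/ gcdn u M).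
  rewrite -{2}(divnK (dvdn_gcdr u M)) mulKn //.
  by rewrite divn_gt0 // dvdn_leq // dvdn_gcdr.
rewrite divn_count_dvd big_add1 /=; apply: eq_bigr => j _; congr (nat_of_bool _).
set g := gcdn u M in g_gt0 *.
have -> : (M %| u * j.+1) = (M %/ g * g %| u %/ g * j.+1 * g).
  by rewrite mulnAC !divnK ?dvdn_gcdl ?dvdn_gcdr.
rewrite dvdn_pmul2r //; apply: Gauss_dvdr.
rewrite coprime_sym /coprime -(eqn_pmul2r g_gt0) mul1n.
by rewrite muln_gcdl !divnK ?dvdn_gcdl ?dvdn_gcdr.
Qed.

(** After [j] is replaced by [M - j] the equation reads [M * i = u * j], which has a
    solution [i] exactly when [M] divides [u * j]. *)
Lemma lattice_count (u M : nat) : 0 < M ->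
  \sum_(0 <= j < M.+1) \sum_(0 <= i < u.+1) (u * j + M * i == u * M) = (gcdn u M).+1.
Proof.
move=> M_gt0; rewrite -(sum_dvdn_gcd u M_gt0) big_nat_rev /=.
apply: eq_big_nat => j /andP[_ lt_j].
rewrite -(@sum_eqmul M u (u * j)) //; last by rewrite mulnC leq_mul2r -ltnS lt_j orbT.
apply: eq_bigr => i _; congr (nat_of_bool _).
rewrite add0n subSS -[u * M](@subnK (u * j)); last by rewrite leq_mul2l -ltnS lt_j orbT.
by rewrite -mulnBr eqn_add2l.
Qed.

(** The product of the two geometric sums is the generating function of the numbers
    [u * j + M * i], so that its coefficient of rank [u * M] is given by
    [lattice_count]; the base [z] exceeds the number of pairs [(j, i)], hence every
    coefficient. *)
Lemma gcd_digit (u M : nat) : 0 < M ->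
  (gcdn u M).+1 = let z := M.+1 * u.+1 + 1 in digit z (G 0 (z ^ u) M * G 0 (z ^ M) u) (u * M).
Proof.
move=> M_gt0 /=; set z := _ * _ + 1; rewrite -(lattice_count u M_gt0).
(* [c e] is the coefficient of rank [e] of the product. *)
pose c e := \sum_(0 <= j < M.+1) \sum_(0 <= i < u.+1) (u * j + M * i == e).
have lt_c e : c e < z.
  rewrite /z addn1 ltnS /c -[M.+1 * u.+1]/((M.+1 - 0) * u.+1) -sum_nat_const_nat.
  apply: leq_sum => j _; rewrite -[X in _ <= X]muln1 -[u.+1 in X in _ <= X]subn0.
  by rewrite -sum_nat_const_nat; apply: leq_sum => i _; case: eqP.
pose N := (u * M + M * u).+1.
have -> : G 0 (z ^ u) M * G 0 (z ^ M) u = \sum_(0 <= e < N) c e * z ^ e.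
  under [RHS]eq_bigr => e _ do rewrite /c big_distrl /=.
  rewrite exchange_big /G big_distrl /=; apply: eq_big_nat => j /andP[_ lt_j].
  under [RHS]eq_bigr => e _ do rewrite big_distrl /=.
  rewrite exchange_big big_distrr /=; apply: eq_big_nat => i /andP[_ lt_i].
  rewrite !expn0 !mul1n -!expnM -expnD.
  have lt_e : u * j + M * i < N by rewrite /N ltnS leq_add // leq_mul2l -ltnS ?lt_i ?lt_j orbT.
  rewrite big_mkord (bigD1 (Ordinal lt_e)) //= eqxx mul1n big1 ?addn0 // => e.
  by rewrite -val_eqE /= eq_sym => /negPf ->.
by rewrite digit_sum // /N ltnS leq_addr.
Qed.

Lemma arith_gcd (k : nat) (f g : k.-tuple nat -> nat) :
    arith f -> arith g -> (forall v, 0 < f v) -> (forall v, 0 < g v) ->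
  arith (fun v => gcdn (f v) (g v)).
Proof.
move=> df dg f_gt0 g_gt0.
pose z v := (g v + 1) * (f v + 1) + 1.
have d1 (h : k.-tuple nat -> nat) : arith h -> arith (fun v => h v + 1).
  by move=> dh; apply: arith_add => //; apply: arith_cst.
have dz : arith z by apply/d1/arith_mul; apply: d1.
apply: (@arith_ext _ (fun v =>
    digit (z v) (G 0 (z v ^ f v) (g v) * G 0 (z v ^ g v) (f v)) (f v * g v) - 1)).
  move=> v; have := gcd_digit (f v) (g_gt0 v); rewrite /z /= !addn1 => <-.
  by rewrite subn1.
have z_gt1 v : 1 < z v by rewrite /z addn1 ltnS muln_gt0 !addn1.
apply: arith_sub; last exact: arith_cst.
apply: arith_mod => //; apply: arith_div; last by apply: arith_exp => //; apply: arith_mul.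
apply: arith_mul; apply: arith_G => //; try exact: arith_exp.
  by move=> v; apply: leq_trans (z_gt1 v) _; rewrite -{1}[z v]expn1 leq_exp2l.
by move=> v; apply: leq_trans (z_gt1 v) _; rewrite -{1}[z v]expn1 leq_exp2l.
Qed.

(** With [y = 2 ^ s - 1], the number [(2 ^ j) ^ s] is [(1 + y) ^ j], congruent to
    [1 + j * y] modulo [y ^ 2]. *)
Lemma log2_mod (s j : nat) : 0 < s -> j < 2 ^ s - 1 ->
  j = ((2 ^ j) ^ s %% (2 ^ s - 1) ^ 2) %/ (2 ^ s - 1).
Proof.
move=> s_gt0; set y := 2 ^ s - 1 => lt_j; have y_gt0 : 0 < y by lia.
have [y1|y_gt1] := leqP y 1.
  have -> : j = 0 by lia.
  have -> : y = 1 by lia.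
  by rewrite exp1n modn1 div0n.
have sE : 2 ^ s = y + 1 by rewrite /y subnK ?expn_gt0.
rewrite -expnM mulnC expnM sE.
have -> : (y + 1) ^ j = 1 + j * y %[mod y ^ 2].
  elim: j {lt_j} => // j IH; rewrite expnSr -modnMml IH modnMml.
  have -> : (1 + j * y) * (y + 1) = j * y ^ 2 + (1 + j.+1 * y) by ring.
  by rewrite modnMDl.
rewrite modn_small; last by nia.
by rewrite addnC divnMDl // divn_small // addn0.
Qed.

Lemma arith_logn2 (k : nat) (f : k.-tuple nat -> nat) :
  arith f -> (forall v, 0 < f v) -> arith (fun v => logn 2 (f v)).
Proof.
move=> df f_gt0.
have d2 (h : k.-tuple nat -> nat) : arith h -> arith (fun v => 2 ^ h v).
  by apply: arith_exp; exact: arith_cst.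
(* The exponent [s] is such that the valuation, smaller than [f v], is below
   [2 ^ s - 1]. *)
pose s v := f v + 1; pose y v := 2 ^ s v - 1.
apply: (@arith_ext _ (fun v => (gcdn (f v) (2 ^ f v) ^ s v %% y v ^ 2) %/ y v)).
  move=> v; have lt_log := ltn_logl 2 (f_gt0 v).
  have -> : gcdn (f v) (2 ^ f v) = 2 ^ logn 2 (f v).
    (* Since the valuation is less than [f v], the 2-part divides [2 ^ f v]. *)
    have [c co2 fE] := pfactor_coprime (isT : prime 2) (f_gt0 v).
    rewrite {1}fE -[in 2 ^ f v](subnK (ltnW lt_log)) expnD -muln_gcdl.
    by move: co2; rewrite coprime_sym => /(coprimeXr (f v - logn 2 (f v))) /eqP ->; rewrite mul1n.
  rewrite -log2_mod // /s ?addn1 //.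
  by have := ltn_expl (f v) (ltnSn 1); rewrite expnS; lia.
have ds : arith s by apply: arith_add => //; apply: arith_cst.
have dy : arith y by apply: arith_sub; [apply: d2 | apply: arith_cst].
apply: arith_div => //; apply: arith_mod; apply: arith_exp => //; last exact: arith_cst.
apply: arith_gcd => //; first exact: d2.
by move=> v; rewrite expn_gt0.
Qed.

Lemma arith_HW (k : nat) (f : k.-tuple nat -> nat) : arith f -> arith (fun v => HW (f v)).
Proof.
move=> df; apply: arith_ext (fun v => esym (HW_logn (f v))) _.
apply: arith_logn2; last by move=> v; rewrite bin_gt0 -addnn leq_addr.
by apply: arith_bin => //; apply: arith_ext (fun v => addnn (f v)) _; apply: arith_add.
Qed.

(** * Counting zeros with the Hamming weight *)

Local Open Scope ring_scope.

(** Expanding the product amounts to choosing one [j] per factor, that is, the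
    digits of a number below [t ^ k]. *)
Lemma prod_sum_digits (R : comNzRingType) (t k : nat) (F : nat -> nat -> R) : (0 < t)%N ->
  \prod_(0 <= i < k) \sum_(0 <= j < t) F i j
    = \sum_(0 <= e < t ^ k) \prod_(0 <= i < k) F i (digit t e i).
Proof.
move=> t_gt0; elim: k => [|k IH]; first by rewrite expn0 big_nat1 !big_geq.
rewrite big_nat_recr //= IH expnSr big_mul_split mulr_sumr; apply: eq_big_nat => j /andP[_ lt_j].
rewrite mulr_suml; apply: eq_big_nat => e /andP[_ lt_e].
rewrite big_nat_recr //=; congr (_ * _); last first.
  by rewrite /digit addnC divnMDl ?expn_gt0 ?t_gt0 // divn_small // addn0 modn_small.
apply: eq_big_nat => i /andP[_ lt_i]; rewrite /digit.
have -> : (t ^ k = t ^ (k - i).-1 * t * t ^ i)%N.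
  by rewrite -expnSr -expnD; congr (_ ^ _)%N; lia.
by rewrite !mulnA addnC divnMDl ?expn_gt0 ?t_gt0 // modnMDl.
Qed.

Definition monomial_val (k : nat) (mu : monomial) (x : nat -> nat) : int :=
  coef mu * \prod_(1 <= i < k.+1) (base mu i ^ (bexp mu i * x i) * x i ^ pexp mu i)%N%:Z.

(** The indices of the coordinates start at 1, those of the digits at 0. *)
Definition point (t e i : nat) : nat := digit t e i.-1.

Lemma calA_sum (t w k : nat) (mu : monomial) : (0 < t)%N ->
  calA t w mu k = - (2 ^+ w - 1)
    * \sum_(0 <= e < t ^ k) (2 ^ (2 * w * e))%N%:Z * monomial_val k mu (point t e).
Proof.
move=> t_gt0; rewrite /calA /monomial_val -mulrA; congr (_ * _).
under [in RHS]eq_bigr => e _ do rewrite mulrCA.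
rewrite -mulr_sumr; congr (_ * _); rewrite big_add1 /=.
under eq_bigr => i _ do rewrite /G prednK // (big_morph Posz PoszD (erefl _)).
rewrite prod_sum_digits //; apply: eq_big_nat => e /andP[_ lt_e].
rewrite big_add1 /= -[X in (2 * w * X)%N](sum_digit t_gt0 lt_e) big_distrr /= expn_sum.
rewrite (big_morph Posz PoszM (erefl _)) -big_split /=; apply: eq_bigr => i _.
rewrite -PoszM; congr Posz; rewrite /point /=.
rewrite expnMn -!expnM mulnCA.
by congr (_ * _)%N; [congr (_ ^ _)%N; ring | rewrite mulnC].
Qed.

(** The quotient is exact because [2 ^ (2 * w) - 1 = (2 ^ w - 1) * (2 ^ w + 1)]; the
    remaining factor is a geometric sum. *)
Lemma calC_sum (t w k : nat) (eps : int) :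
  calC t w eps k = (2 ^+ w - eps + 1) * (2 ^+ w - 1)
    * \sum_(0 <= e < t ^ k) (2 ^ (2 * w * e))%N%:Z.
Proof.
rewrite /calC -mulrA; congr (_ * _).
have geo N : \sum_(0 <= e < N) (2 ^ (2 * w * e))%N%:Z * (2 ^+ (2 * w) - 1)
    = 2 ^+ (2 * w * N) - 1 :> int.
  elim: N => [|N IH]; first by rewrite big_geq // muln0 expr0 subrr.
  by rewrite big_nat_recr //= IH mulnS exprD -natz natrX; ring.
rewrite -geo -mulr_suml.
have -> : 2 ^+ (2 * w) - 1 = (2 ^+ w - 1) * (2 ^+ w + 1) :> int.
  by rewrite mulnC exprM; ring.
rewrite mulrA mulzK 1?mulrC // gt_eqF // -[1]/(1%:Z) addr_gt0 // exprn_gt0 //.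
Qed.

(** The block of the point of rank [e] is [(2 ^ w - 1) * (2 ^ w + 1 - P)], with [P] the
    value at this point: its weight is [2 * w] if [P = 0], and [w] otherwise. *)
Lemma HW_calC_calA (t w k : nat) (eps : int) (ms : seq monomial) :
    (0 < t)%N ->
    (forall e, (e < t ^ k)%N ->
       0 <= eps + \sum_(mu <- ms) monomial_val k mu (point t e) <= 2 ^+ w) ->
  let M := calC t w eps k + \sum_(mu <- ms) calA t w mu k in
  0 <= M /\
  HW `|M| = (w * (t ^ k + count (fun e =>
     (eps + \sum_(mu <- ms) monomial_val k mu (point t e) == 0)%R) (iota 0 (t ^ k))))%N.
Proof.
move=> t_gt0 ltP M.
pose P (e : nat) : int := eps + \sum_(mu <- ms) monomial_val k mu (point t e).
pose F (e : nat) := ((2 ^ w - 1) * (2 ^ w + 1 - `|P e|))%N.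
have le_P e : (e < t ^ k)%N -> (`|P e| <= 2 ^ w)%N /\ P e = `|P e|%N.
  move=> /ltP /andP[P_ge0 P_le]; have PE : P e = `|P e|%N by rewrite gez0_abs.
  by split=> //; rewrite -lez_nat -PE -natz natrX.
have pow2 : 2 ^+ w = (2 ^ w)%N :> int by rewrite -natz natrX.
have ME : M = (\sum_(0 <= e < t ^ k) 2 ^ (2 * w * e) * F e)%N.
  rewrite /M calC_sum (eq_bigr _ (fun mu _ => calA_sum w k mu t_gt0)) -mulr_sumr exchange_big /=.
  rewrite (big_morph Posz PoszD (erefl _)) !mulr_sumr -big_split /=.
  apply: eq_big_nat => e /andP[_ /le_P[le_e PE]].
  rewrite -mulr_sumr PoszM /F PoszM -!subzn ?expn_gt0 //; last by rewrite addn1 leqW.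
  by rewrite -PE /P PoszD pow2; ring.
have ltF e : (e < t ^ k)%N -> (F e < 2 ^ (2 * w))%N.
  move=> _; apply: (@leq_ltn_trans ((2 ^ w - 1) * (2 ^ w + 1))).
    by rewrite leq_mul2l leq_subr orbT.
  have := expn_gt0 2 w; rewrite mul2n -addnn expnD /=; nia.
have [_ HWS] := HW_blocks ltF.
split; first by rewrite ME.
rewrite ME /= HWS.
have HWF e : (0 <= e < t ^ k)%N -> HW (F e) = (w * (1 + (P e == 0)))%N.
  move=> /andP[_ /le_P[le_e PE]]; rewrite /F; have [P0|PN0] := eqVneq (P e) 0.
    have -> : ((2 ^ w - 1) * (2 ^ w + 1 - `|P e|) = 2 ^ (2 * w) - 1 - 0)%N.
      have := expn_gt0 2 w; rewrite P0 mul2n -addnn expnD /=; nia.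
    have := @HW_compl (2 * w) 0 (expn_gt0 2 _).
    by rewrite HW0 add0n => ->; lia.
  by rewrite HW_mul_pred ?muln1 ?addn0 //; lia.
rewrite (eq_big_nat _ _ HWF) -big_distrr /=; congr (_ * _)%N.
rewrite big_split /= sum_nat_const_nat subn0 muln1; congr (_ + _)%N.
rewrite -sum1_count [RHS]big_mkcond /index_iota subn0.
by apply: eq_bigr => e _; rewrite -[P e]/(eps + _); case: ifP.
Qed.

(** * Integer-valued arithmetic terms *)

(** Arithmetic terms only take natural values, so an integer-valued function is
    represented by a difference of two of them. *)
Definition arithz (k : nat) (f : k.-tuple nat -> int) : Prop :=
  exists g h : k.-tuple nat -> nat,
    [/\ arith g, arith h & forall v, f v = (g v)%:Z - (h v)%:Z].

Section IntClosure.
Variable k : nat.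
Implicit Types f g : k.-tuple nat -> int.

Lemma arithz_ext f g : f =1 g -> arithz f -> arithz g.
Proof. by move=> fg [p [q [dp dq fE]]]; exists p, q; split=> // v; rewrite -fg. Qed.

Lemma arithz_nat (h : k.-tuple nat -> nat) : arith h -> arithz (fun v => (h v)%:Z).
Proof.
by move=> dh; exists h, (fun=> 0%N); split=> // [|v]; [apply: arith_cst | rewrite subr0].
Qed.

Lemma arithz_opp f : arithz f -> arithz (fun v => - f v).
Proof. by move=> [p [q [dp dq fE]]]; exists q, p; split=> // v; rewrite fE opprB. Qed.

Lemma arithz_add f g : arithz f -> arithz g -> arithz (fun v => f v + g v).
Proof.
move=> [p [q [dp dq fE]]] [r [s [dr ds gE]]].
exists (fun v => p v + r v)%N, (fun v => q v + s v)%N; split; try exact: arith_add.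
by move=> v; rewrite fE gE !PoszD; ring.
Qed.

Lemma arithz_mul f g : arithz f -> arithz g -> arithz (fun v => f v * g v).
Proof.
move=> [p [q [dp dq fE]]] [r [s [dr ds gE]]].
exists (fun v => p v * r v + q v * s v)%N, (fun v => p v * s v + q v * r v)%N; split.
- by apply: arith_add; apply: arith_mul.
- by apply: arith_add; apply: arith_mul.
by move=> v; rewrite fE gE !PoszD !PoszM; ring.
Qed.

Lemma arithz_cst (c : int) : arithz (fun _ : k.-tuple nat => c).
Proof.
case: c => c; first exact/arithz_nat/arith_cst.
apply: (@arithz_ext (fun=> - (c.+1)%:Z)) => [v|]; first by rewrite NegzE.
exact/arithz_opp/arithz_nat/arith_cst.
Qed.

Lemma arithz_exp f (c : nat) : arithz f -> arithz (fun v => f v ^+ c).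
Proof.
move=> df; elim: c => [|c IH].
  by apply: (@arithz_ext (fun=> 1)) => [v|]; [rewrite expr0 | apply: arithz_cst].
by apply: (@arithz_ext (fun v => f v * f v ^+ c)) => [v|]; [rewrite exprS | apply: arithz_mul].
Qed.

Lemma arithz_pow2 (h : k.-tuple nat -> nat) : arith h -> arithz (fun v => 2 ^+ h v).
Proof.
move=> dh; apply: (@arithz_ext (fun v => (2 ^ h v)%N%:Z)) => [v|].
  by rewrite -natz natrX.
by apply/arithz_nat/arith_exp => //; apply: arith_cst.
Qed.

Lemma arith_absz f : arithz f -> arith (fun v => `|f v|%N).
Proof.
move=> [p [q [dp dq fE]]].
apply: (@arith_ext _ (fun v => p v - q v + (q v - p v))%N) => [v|].
  by rewrite fE; lia.
by apply: arith_add; apply: arith_sub.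
Qed.

Variables t w : k.-tuple nat -> nat.
Hypotheses (dt : arith t) (dw : arith w).
Hypotheses (t_gt0 : forall v, (0 < t v)%N) (w_gt0 : forall v, (0 < w v)%N).

Lemma arithz_calC (eps : k.-tuple nat -> int) (l : nat) :
  arithz eps -> arithz (fun v => calC (t v) (w v) (eps v) l).
Proof.
move=> deps; apply: arithz_mul.
  apply: arithz_add; last exact: arithz_cst.
  by apply: arithz_add; [exact: arithz_pow2 | exact: arithz_opp].
apply: (@arithz_ext (fun v => ((2 ^ (2 * w v * t v ^ l) - 1) %/ (2 ^ w v + 1))%N%:Z)).
  move=> v; rewrite -divz_nat -subzn ?expn_gt0 // PoszD.
  by rewrite -[(2 ^ (2 * w v * t v ^ l))%N%:Z]natz -[(2 ^ w v)%N%:Z]natz !natrX.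
have d2 (h : k.-tuple nat -> nat) : arith h -> arith (fun v => 2 ^ h v)%N.
  by apply: arith_exp; exact: arith_cst.
apply/arithz_nat/arith_div.
  apply: arith_sub; last exact: arith_cst.
  apply: d2; apply: arith_mul; first by apply: arith_mul => //; apply: arith_cst.
  by apply: arith_exp => //; apply: arith_cst.
by apply: arith_add; [exact: d2 | apply: arith_cst].
Qed.

Lemma arithz_calA (a : k.-tuple nat -> int) (be ga : seq (nat * nat)) (l : nat) :
  arithz a -> arithz (fun v => calA (t v) (w v) (mon2 (a v) be ga) l).
Proof.
move=> da; rewrite /calA /=; apply: arithz_mul.
  apply: arithz_mul => //; apply/arithz_opp/arithz_add; first exact: arithz_pow2.
  exact: (arithz_cst (-1)).
apply: (@arithz_ext (fun v => (\prod_(0 <= i < l)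
    G (exponents ga i.+1) (2 ^ (2 * w v * t v ^ i) * 2 ^ exponents be i.+1) (t v - 1))%N%:Z)).
  move=> v; rewrite big_add1 /= (big_morph Posz PoszM (erefl _)).
  by apply: eq_bigr => i _; rewrite subn1.
apply/arithz_nat/arith_prod => i _; apply: arith_G.
- apply: arith_mul; last exact: arith_cst.
  apply: arith_exp; first exact: arith_cst.
  apply: arith_mul; first by apply: arith_mul => //; apply: arith_cst.
  by apply: arith_exp => //; apply: arith_cst.
- by apply: arith_sub => //; apply: arith_cst.
move=> v; rewrite -expnD -{1}(expn0 2) ltn_exp2l //.
by rewrite ltn_addr // !muln_gt0 w_gt0 expn_gt0 t_gt0.
Qed.

Lemma arithz_sum_nil (F : k.-tuple nat -> monomial -> int) :
  arithz (fun v => \sum_(mu <- [::]) F v mu).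
Proof. by apply: arithz_ext (arithz_cst 0) => v; rewrite big_nil. Qed.

(** A list of monomials whose coefficients depend on the arguments is treated one
    entry at a time. *)
Lemma arithz_sum_cons (h : k.-tuple nat -> monomial) (ms : k.-tuple nat -> seq monomial)
    (F : k.-tuple nat -> monomial -> int) :
  arithz (fun v => F v (h v)) -> arithz (fun v => \sum_(mu <- ms v) F v mu) ->
  arithz (fun v => \sum_(mu <- h v :: ms v) F v mu).
Proof.
move=> dh dms; apply: arithz_ext (arithz_add dh dms) => v; by rewrite big_cons.
Qed.

End IntClosure.

Lemma root_t_gt0 (m n : nat) : (0 < root_t m n)%N.
Proof. by rewrite /root_t expn_gt0. Qed.

Lemma root_w_gt0 (m n : nat) : (0 < root_w m n)%N.
Proof. by rewrite /root_w addnS. Qed.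

Lemma arithz_root_expr :
  arithz (fun v : 2.-tuple nat => root_expr (tnth v ord0) (tnth v ord_max)).
Proof.
pose m (v : 2.-tuple nat) := tnth v ord0; pose n (v : 2.-tuple nat) := tnth v ord_max.
have dm : arith m by apply: arith_var.
have dn : arith n by apply: arith_var.
have dc c : arith (fun _ : 2.-tuple nat => c) by apply: arith_cst.
have dE : arith (fun v => n v * m v ^ 2 + n v * m v)%N.
  by apply: arith_add; apply: arith_mul => //; apply: arith_exp.
have dt : arith (fun v => root_t (m v) (n v)) by apply: arith_exp => //; apply: arith_add.
have dw : arith (fun v => root_w (m v) (n v)).
  apply: arith_add => //; apply: arith_add; last exact: arith_mul.
  by apply: arith_exp => //; apply: arith_add.
have t_gt0 v := root_t_gt0 (m v) (n v); have w_gt0 v := root_w_gt0 (m v) (n v).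
apply: arithz_add; last exact: (arithz_cst _ (-1)).
apply: arithz_add; last first.
  apply/arithz_opp/arithz_pow2; apply: arith_mul => //; exact: arith_add.
apply: arithz_nat; apply: arith_div => //; apply: arith_HW; apply: arith_absz.
have zm : arithz (fun v => (m v)%:Z) by apply: arithz_nat.
have zn : arithz (fun v => (n v)%:Z) by apply: arithz_nat.
rewrite /root_M /=; apply: arithz_add.
  apply: arithz_calC => //; apply: arithz_add; first exact: arithz_cst.
  exact: (arithz_exp _ zn).
rewrite /root_monomials.
do 31 (refine (arithz_sum_cons (arithz_calA dt dw t_gt0 w_gt0 _ _ _ _) _);
  first by repeat first [exact: zm | exact: zn | exact: arithz_cst | apply: arithz_opp
    | apply: arithz_add | apply: arithz_mul | apply: arithz_exp]).
exact: arithz_sum_nil.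
Qed.

(** * The sum of squares *)

(** A transparent version of [exponents], whose sum does not compute. *)
Definition exponent_of (s : seq (nat * nat)) (i : nat) : nat :=
  foldr (fun p a => if p.1 == i then (p.2 + a)%N else a) 0%N s.

Lemma exponentsE s i : exponents s i = exponent_of s i.
Proof.
rewrite /exponents; elim: s => [|p s IH] /=; first by rewrite big_nil.
by rewrite big_cons IH.
Qed.

Lemma monomial_val_mon2 (a : int) (be ga : seq (nat * nat)) (x : nat -> nat) :
  let f i := (2 ^ x i)%N%:Z ^+ exponent_of be i * (x i)%:Z ^+ exponent_of ga i in
  monomial_val 7 (mon2 a be ga) x = a * (f 1%N * f 2%N * f 3%N * f 4%N * f 5%N * f 6%N * f 7%N).
Proof.
move=> f; rewrite /monomial_val /=; congr (_ * _).
rewrite big_ltn // big_ltn // big_ltn // big_ltn // big_ltn // big_ltn // big_nat1.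
have fE i : (2 ^ (exponents be i * x i) * x i ^ exponents ga i)%N%:Z = f i.
  by rewrite /f !exponentsE PoszM [(_ * x i)%N]mulnC expnM -!natz !natrX.
by rewrite !fE !mulrA.
Qed.

Definition root_poly (m n : nat) (x : nat -> nat) : int :=
  ((2 ^ x 1)%N%:Z - (x 4%N)%:Z - (x 5%N)%:Z - (x 7%N)%:Z - 1) ^+ 2
  + ((x 4%N)%:Z + (x 6%N)%:Z - n%:Z) ^+ 2
  + ((2 ^ x 2)%N%:Z - (x 4%N)%:Z - (x 3%N)%:Z * ((2 ^ x 1)%N%:Z - (x 7%N)%:Z)) ^+ 2
  + ((x 1%N)%:Z - (m%:Z + 1) * (x 7%N)%:Z - 1) ^+ 2
  + ((x 2%N)%:Z - m%:Z * (x 1%N)%:Z) ^+ 2.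

(** The powers of 2 occur in the monomials only through [2 ^ x_1] and [2 ^ x_2], so
    that both sides are polynomials in these two numbers and the variables. *)
Lemma root_polyE (m n : nat) (x : nat -> nat) :
  2 + n%:Z ^+ 2 + \sum_(mu <- root_monomials m n) monomial_val 7 mu x = root_poly m n x.
Proof.
rewrite /root_monomials /root_poly !big_cons big_nil !monomial_val_mon2 /=.
move: (2 ^ x 1)%N (2 ^ x 2)%N (2 ^ x 3)%N (2 ^ x 4)%N (2 ^ x 5)%N (2 ^ x 6)%N (2 ^ x 7)%N.
move=> y1 y2 y3 y4 y5 y6 y7; ring.
Qed.

Lemma sqr_le_of_norm (b c : int) : - c <= b <= c -> b ^+ 2 <= c ^+ 2.
Proof. by move=> /andP[ge_b le_b]; rewrite -subr_ge0 subr_sqr mulr_ge0; lia. Qed.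

Lemma root_poly_ge0 (m n : nat) (x : nat -> nat) : 0 <= root_poly m n x.
Proof. by rewrite /root_poly !addr_ge0 ?sqr_ge0. Qed.

(** Every variable is below [t] and every power of 2 is at most [2 ^ t.-1], so each of
    the five squared quantities is at most [4 * t * 2 ^ t.-1] in absolute value. *)
Lemma root_poly_bound (m n t : nat) (x : nat -> nat) :
    (n < t)%N -> (m < t)%N -> (forall i, x i < t)%N ->
  root_poly m n x <= (80 * (t * 2 ^ t.-1) ^ 2)%N%:Z.
Proof.
move=> lt_n lt_m lt_x; set Y := (2 ^ t.-1)%N.
have le_tY : (t <= Y)%N.
  by have := ltn_expl t.-1 (ltnSn 1); rewrite -/Y; lia.
have pow_le i : (0 < 2 ^ x i <= Y)%N.
  by rewrite expn_gt0 leq_exp2l //; have := lt_x i; lia.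
have -> : (80 * (t * Y) ^ 2)%N%:Z = 5 * (4 * (t * Y)%N%:Z) ^+ 2.
  by rewrite -mulnn !PoszM; ring.
have le_mul a b : (a < t)%N -> (b <= Y)%N -> 0 <= a%:Z * b%:Z <= (t * Y)%N%:Z.
  by move=> /ltnW le_a le_b; rewrite -PoszM; apply/andP; split=> //; apply: leq_mul.
have x_le i : (x i <= Y)%N by apply: leq_trans (ltnW (lt_x i)) le_tY.
have Y_gt0 : (0 < Y)%N by rewrite expn_gt0.
have le_t : (t <= t * Y)%N by rewrite leq_pmulr.
have le_Y : (Y <= t * Y)%N by rewrite leq_pmull //; have := lt_x 1%N; lia.
have := le_mul _ _ (lt_x 3%N) (x_le 7%N).
have /andP[_ y1_le] := pow_le 1%N; have /andP[_ y2_le] := pow_le 2%N.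
have := le_mul _ _ (lt_x 3%N) y1_le.
have := le_mul _ _ lt_m (x_le 1%N); have := le_mul _ _ lt_m (x_le 7%N).
have [x1 x2 x3 x4] := And4 (lt_x 1%N) (lt_x 2%N) (lt_x 3%N) (lt_x 4%N).
have [x5 x6 x7 _] := And4 (lt_x 5%N) (lt_x 6%N) (lt_x 7%N) isT.
rewrite /root_poly; set c : int := 4 * (t * Y)%N%:Z.
have -> : 5 * c ^+ 2 = c ^+ 2 + c ^+ 2 + c ^+ 2 + c ^+ 2 + c ^+ 2 by ring.
rewrite {}/c.
move: (2 ^ x 1)%N (2 ^ x 2)%N (t * Y)%N y1_le y2_le le_t le_Y x1 x2 x3 x4 x5 x6 x7.
move=> y1 y2 D *.
do 4 (apply: lerD; last by apply: sqr_le_of_norm; lia).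
by apply: sqr_le_of_norm; lia.
Qed.

Lemma root_poly_eq0 (m n : nat) (x : nat -> nat) :
  (root_poly m n x == 0) =
  [&& x 1 == m.+1 * x 7 + 1, x 2 == m * x 1, x 4 + x 6 == n,
      x 4 + x 5 + x 7 + 1 == 2 ^ x 1
    & 2 ^ x 2 == x 4 + x 3 * (2 ^ x 1 - x 7)]%N.
Proof.
rewrite /root_poly !paddr_eq0 ?addr_ge0 ?sqr_ge0 // !sqrf_eq0.
move: (2 ^ x 1)%N (2 ^ x 2)%N => y1 y2; apply/idP/idP.
  move=> /andP[/andP[/andP[/andP[/eqP e1 /eqP e2] /eqP e3] /eqP e4] /eqP e5].
  have le7 : (x 7 <= y1)%N by lia.
  have mE : (x 3 * (y1 - x 7))%N%:Z = (x 3%N)%:Z * (y1%:Z - (x 7%N)%:Z) by rewrite PoszM subzn.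
  apply/and5P; split; apply/eqP; lia.
move=> /and5P[/eqP e1 /eqP e2 /eqP e3 /eqP e4 /eqP e5].
have le7 : (x 7 <= y1)%N by lia.
have mE : (x 3 * (y1 - x 7))%N%:Z = (x 3%N)%:Z * (y1%:Z - (x 7%N)%:Z) by rewrite PoszM subzn.
rewrite -!andbA; apply/and5P; split; apply/eqP; lia.
Qed.

(** * The zeros of the sum of squares *)

Local Open Scope nat_scope.

(** The [i]-th coordinate of the zero whose last coordinate is [a]. *)
Definition root_sol (m n a i : nat) : nat :=
  let x1 := m.+1 * a + 1 in
  match i with
  | 1 => x1
  | 2 => m * x1
  | 3 => 2 ^ (m * x1) %/ (2 ^ x1 - a)
  | 4 => a ^ m
  | 5 => 2 ^ x1 - (a ^ m + a + 1)
  | 6 => n - a ^ m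
  | 7 => a
  | _ => 0
  end.

Lemma modulus_gt (m a : nat) : a ^ m + a < 2 ^ (m.+1 * a + 1).
Proof.
have lt_a : a < 2 ^ a by apply: ltn_expl.
have le_am : a ^ m <= 2 ^ (m.+1 * a).
  apply: (@leq_trans ((2 ^ a) ^ m)); first by case: (m) => // p; rewrite leq_exp2r // ltnW.
  by rewrite -expnM leq_exp2l // mulSn mulnC leq_addl.
have le_a : 2 ^ a <= 2 ^ (m.+1 * a) by rewrite leq_exp2l // mulSn leq_addr.
by rewrite addn1 expnS mul2n -addnn -addnS leq_add // (leq_trans lt_a).
Qed.

(** Modulo [2 ^ x1 - a] the number [2 ^ x1] is [a]. *)
Lemma pow_mod_modulus (m a : nat) : let x1 := m.+1 * a + 1 in
  2 ^ (m * x1) %% (2 ^ x1 - a) = a ^ m.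
Proof.
move=> x1; have := modulus_gt m a; rewrite -/x1 => gt_q.
rewrite mulnC expnM -{1}(@subnK a (2 ^ x1)); last by lia.
rewrite -modnXm modnDl modnXm modn_small //; lia.
Qed.

Local Open Scope ring_scope.

Lemma root_poly_zeroP (m n : nat) (x : nat -> nat) :
  reflect ((x 7 ^ m <= n)%N /\ forall i, (0 < i <= 7)%N -> x i = root_sol m n (x 7%N) i)
    (root_poly m n x == 0).
Proof.
rewrite root_poly_eq0; apply: (iffP and5P).
  move=> [/eqP e1 /eqP e2 /eqP e3 /eqP e4 /eqP e5].
  have := pow_mod_modulus m (x 7%N); have := modulus_gt m (x 7%N).
  rewrite /= -e1 -e2 => gt_q modE.
  have x4_lt : (x 4 < 2 ^ x 1 - x 7)%N by lia.
  have x4E : x 4%N = (x 7 ^ m)%N.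
    by rewrite -modE e5 addnC modnMDl modn_small.
  have x3E : x 3%N = (2 ^ x 2 %/ (2 ^ x 1 - x 7))%N.
    by rewrite e5 addnC divnMDl ?divn_small ?addn0 //; lia.
  split; first by lia.
  by case=> [|[|[|[|[|[|[|[|i]]]]]]]] //= _; rewrite -?e1 -?e2; lia.
move=> [le_am xE].
have [x1 x2 x3 x4] := And4 (xE 1%N isT) (xE 2%N isT) (xE 3%N isT) (xE 4%N isT).
have [x5 x6 _ _] := And4 (xE 5%N isT) (xE 6%N isT) isT isT.
have := modulus_gt m (x 7%N); have := pow_mod_modulus m (x 7%N).
move: x3 x5; rewrite /= in x1 x2 x4 x6 *; rewrite -x1 in x2 *.
rewrite -x2 -x4 => x3 x5 modE gt_q.
split; apply/eqP; rewrite // ?x5 ?x6; try lia.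
Qed.

Lemma leq_of_pow (a m n : nat) : (0 < m)%N -> (a ^ m <= n)%N -> (a <= n)%N.
Proof.
case: a => // a m_gt0; apply: leq_trans.
by rewrite -{1}[a.+1]expn1 leq_pexp2l.
Qed.

(** The choice of [t] is dictated by the quotient [x_3], of the order of
    [2 ^ ((m - 1) * x_1)], with [a <= n]. *)
Lemma root_sol_lt (m n a i : nat) : (0 < n)%N -> (1 < m)%N -> (a ^ m <= n)%N ->
  (root_sol m n a i < root_t m n)%N.
Proof.
move=> n_gt0 m_gt1 le_am; have le_a := leq_of_pow (ltnW m_gt1) le_am.
rewrite /root_t; set e := (n * m ^ 2 + n * m + 1)%N.
have lt_e : (e < 2 ^ e)%N by apply: ltn_expl.
have le_E : (m.+1 * a + 1 <= e)%N by rewrite /e; nia.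
have lt_X : (2 ^ (m.+1 * a + 1) <= 2 ^ e)%N by rewrite leq_exp2l.
have gt_q := modulus_gt m a.
have lt_n : (n < e)%N by rewrite /e; nia.
(* All coordinates but the second and the third are at most [e] or at most
   [2 ^ x1], so that arithmetic settles them. *)
case: i => [|[|[|[|[|[|[|[|i]]]]]]]] //=; try lia.
- have : (e.-1 < 2 ^ e.-1)%N by apply: ltn_expl.
  have -> : (2 ^ e = 2 ^ e.-1 + 2 ^ e.-1)%N by rewrite addnn -mul2n -expnS /e addn1.
  have : (m * (m.+1 * a + 1) <= e.-1 + e.-1)%N by rewrite /e addn1 /=; nia.
  lia.
(* The modulus exceeds [2 ^ (m.+1 * a)], half of [2 ^ x1]. *)
- rewrite ltn_divLR; last by lia.
  apply: (@leq_trans (2 ^ (e + m.+1 * a))%N).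
    rewrite ltn_exp2l // /e; case: (a) le_a => [|b] le_b; nia.
  rewrite expnD leq_mul2l; apply/orP; right.
  have : (a < 2 ^ (m.+1 * a))%N.
    by apply: leq_trans (ltn_expl a (ltnSn 1)) _; rewrite leq_exp2l // mulSn leq_addr.
  rewrite addn1 expnS; lia.
Qed.

(** Since [2 ^ (n * m ^ 2 + n * m + 2) = 2 * t], the right-hand side is
    [2 ^ 9 * (t * 2 ^ t.-1) ^ 2]. *)
Lemma root_w_large (m n : nat) (t := root_t m n) :
  (80 * (t * 2 ^ t.-1) ^ 2 <= 2 ^ root_w m n)%N.
Proof.
have t_gt0 := root_t_gt0 m n.
have -> : root_w m n = (9 + 2 * ((n * m ^ 2 + n * m + 1) + t.-1))%N.
  have E2 : (2 ^ (n * m ^ 2 + n * m + 2) = 2 * t)%N by rewrite /t /root_t -expnS -addnS.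
  by rewrite /root_w E2; lia.
rewrite expnD [(2 * (_ + _))%N]mulnC (expnM 2) (expnD 2 (_ + 1)) -/(root_t m n) -/t.
by rewrite leq_mul2r orbC.
Qed.

(** A zero is determined by its last coordinate [a]. *)
Lemma count_root_zeros (m n : nat) (t := root_t m n) : (0 < n)%N -> (1 < m)%N ->
  count (fun e => root_poly m n (point t e) == 0) (iota 0 (t ^ 7))
    = count (fun a => a ^ m <= n)%N (iota 0 n.+1).
Proof.
move=> n_gt0 m_gt1; have t_gt0 : (0 < t)%N by apply: root_t_gt0.
pose enc a := (\sum_(0 <= i < 7) root_sol m n a i.+1 * t ^ i)%N.
have point_enc a i : (a ^ m <= n)%N -> (0 < i <= 7)%N -> point t (enc a) i = root_sol m n a i.
  move=> le_am /andP[i_gt0 le_i]; rewrite /point /enc.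
  rewrite (@digit_sum t 7 i.-1 (fun i => root_sol m n a i.+1)) ?prednK //.
  by move=> j; apply: root_sol_lt.
rewrite -!size_filter -[RHS](size_map enc); apply/perm_size/uniq_perm.
- by rewrite filter_uniq ?iota_uniq.
- rewrite map_inj_in_uniq ?filter_uniq ?iota_uniq // => a b.
  rewrite !mem_filter => /andP[le_a _] /andP[le_b _] eq_enc.
  by have := point_enc a 7 le_a isT; rewrite eq_enc point_enc.
move=> e; rewrite mem_filter mem_iota leq0n add0n andTb.
apply/andP/mapP => [[/root_poly_zeroP[le_a eE] lt_e]|[a]].
  exists (point t e 7%N).
    by rewrite mem_filter le_a mem_iota ltnS (leq_of_pow _ le_a) // ltnW.
  rewrite -[LHS](sum_digit t_gt0 lt_e); apply: eq_big_nat => i /andP[_ lt_i].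
  by rewrite -eE.
rewrite mem_filter => /andP[le_a _ ->]; split.
  apply/root_poly_zeroP; rewrite point_enc //; split=> // i i_range.
  by rewrite point_enc.
by apply: digits_lt => i; apply: root_sol_lt.
Qed.

Lemma root_M_weight (m n : nat) (t := root_t m n) : (0 < n)%N -> (1 < m)%N ->
  0 <= root_M m n /\ HW `|root_M m n|
    = (root_w m n * (t ^ 7 + count (fun a => a ^ m <= n) (iota 0 n.+1)))%N.
Proof.
move=> n_gt0 m_gt1; rewrite -count_root_zeros //.
have e_lt : (n * m ^ 2 + n * m < t)%N by rewrite /t /root_t addn1 ltnW // ltn_expl.
have lt_n : (n < t)%N by nia.
have lt_m : (m < t)%N by nia.
have t_gt0 : (0 < t)%N by apply: root_t_gt0.
have [|M_ge0 HWM] := @HW_calC_calA t (root_w m n) 7 (2 + n%:Z ^+ 2) (root_monomials m n)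
   t_gt0.
  move=> e _; rewrite root_polyE root_poly_ge0 /=.
  apply: le_trans (root_poly_bound lt_n lt_m _) _.
    by move=> i; rewrite /point /digit ltn_mod.
  by rewrite -(natz (80 * _)) -natrX ler_nat root_w_large.
split=> //; rewrite /root_M HWM; congr (_ * (_ + _))%N.
by apply: eq_count => e; rewrite root_polyE.
Qed.

Lemma count_pow_floor (m n : nat) : (0 < m)%N ->
  (count (fun a => a ^ m <= n)%N (iota 0 n.+1))%:Z
    = Num.floor (m.-root (n%:R : algC)) + 1.
Proof.
move=> m_gt0; set rt := m.-root _.
have rt_ge0 : 0 <= rt by rewrite rootC_ge0 // ler0n.
have rtK : rt ^+ m = n%:R by rewrite rootCK.
have /andP[] := real_floor_itv (ger0_real rt_ge0).
have : 0 <= Num.floor rt by rewrite real_floor_ge0 ?ger0_real.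
case: (Num.floor rt) => // r _; rewrite -[r%:Z + 1]/(Posz (r + 1)) -!pmulrn => le_r lt_r.
have powE a : (a ^ m <= n)%N = (a <= r)%N.
  have -> : (a ^ m <= n)%N = (a%:R <= rt).
    by rewrite -(ler_nat algC) natrX -rtK ler_pXn2r // nnegrE ler0n.
  have [le_ar|lt_ra] := leqP a r; first by rewrite (le_trans _ le_r) // ler_nat.
  apply/negP => /le_lt_trans /(_ lt_r); rewrite ltr_nat; lia.
have le_rn : (r <= n)%N by apply: (leq_of_pow m_gt0); rewrite powE.
rewrite (eq_count powE) -(subnKC (le_rn : r.+1 <= n.+1)%N) iotaD count_cat add0n.
congr Posz; rewrite [X in (_ + X)%N](_ : _ = 0)%N ?addn0; last first.
  by apply/eqP; rewrite -leqn0 leqNgt -has_count; apply/hasPn => a; rewrite mem_iota; lia.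
rewrite addn1 -[RHS](size_iota 0); apply/eqP; rewrite -all_count.
by apply/allP => a; rewrite mem_iota; lia.
Qed.

Theorem theorem8p8 :
  exists T : aterm 2, forall m n : nat, (1 <= n)%N -> (2 <= m)%N ->
    [/\ 0 <= root_M m n,
        (root_w m n %| HW `|root_M m n|)%N,
        (aeval T [tuple m; n])%:Z = root_expr m n
      & Num.floor (m.-root (n%:R : algC)) = root_expr m n].
Proof.
have [T TE] := arith_absz arithz_root_expr.
exists T => m n n_gt0 m_gt1; have [M_ge0 HWM] := root_M_weight n_gt0 m_gt1.
have floorE : Num.floor (m.-root (n%:R : algC)) = root_expr m n.
  rewrite /root_expr HWM mulKn ?root_w_gt0 // PoszD count_pow_floor ?(ltnW m_gt1) //.
  rewrite -[((_ ^ 7)%N)%:Z]natz natrX /root_t natrX -exprM.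
  rewrite [(7 * _)%N]mulnC; ring.
split=> //; first by rewrite HWM dvdn_mulr.
rewrite TE /= gez0_abs // -floorE real_floor_ge0 ?ger0_real ?rootC_ge0 ?ler0n ?(ltnW m_gt1) //.
Qed.
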